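(* Let $(X,\rho)$ be a metric space and let $\mathcal{B}$ be a bornology on $X$ with a closed base. Then $$2^{<\delta(X,\mathcal B)}\le c(\tau_{\mathcal B})\le d(\tau_{\mathcal B})\le cf(\mathcal B)\cdot 2^{<\delta(X,\mathcal B)}.$$
   Context: A bornology on a set $X$ is a family $\mathcal B$ of subsets of $X$ that is closed under taking subsets, closed under finite unions, and satisfies $\bigcup\mathcal B=X$. A base of $\mathcal B$ is a subfamily $\mathcal B_0\subset\mathcal B$ such that every $B\in\mathcal B$ is contained in some $B_0\in\mathcal B_0$; $\mathcal B$ has a closed base if it has a base consisting of closed sets (equivalently $\overline B\in\mathcal B$ for all $B\in\mathcal B$). Put $cf(\mathcal B)=\aleph_0+\min\{|\mathcal B_0|:\mathcal B_0\text{ is a base of }\mathcal B\}$. For a space $Y$, $\delta(Y)$ is $\aleph_0$ plus the least cardinal $\mathfrak m$ such that every open cover of $Y$ has a subcover of cardinality $<\mathfrak m$; $\delta(X,\mathcal B)=\sup\{\delta(\overline B):B\in\mathcal B\}$. For cardinals, $\kappa^{<\lambda}=\sup\{\kappa^{\mathfrak m}:\mathfrak m<\lambda\}$. $C(X)$ is the set of continuous functions $X\to\mathbb R$. The topology $\tau_{\mathcal B}$ on $C(X)$ is induced by the uniformity with basic entourages $[B,\epsilon]=\{(f,g):\forall x\in B,\ |f(x)-g(x)|<\epsilon\}$, where $B\in\mathcal B$, $\epsilon>0$. $c(\tau_{\mathcal B})$ and $d(\tau_{\mathcal B})$ denote the cellularity (supremum of cardinalities of families of pairwise disjoint nonempty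 open sets) and the density of $(C(X),\tau_{\mathcal B})$. Convention: all cardinal functions are taken to be infinite, i.e. $\aleph_0$ is added to their value. *)

(* Defs.v *)
From HB Require Import structures.
From mathcomp Require Import all_boot all_order all_algebra.
From mathcomp Require Import all_classical all_reals.
From mathcomp Require Import topology normedtype.

Set Implicit Arguments.
Unset Strict Implicit.
Unset Printing Implicit Defensive.

Import Order.TTheory GRing.Theory Num.Theory.
Import numFieldNormedType.Exports.

Local Open Scope classical_set_scope.
Local Open Scope card_scope.
Local Open Scope ring_scope.

(* A cardinal is given by any type of that cardinality. Cardinals are compared
   only through [cle] and [clt], i.e. up to equipotence; sum, product and power
   are those of types, aleph_0 is [nat] and 2 is [bool]. *)
Definition cardinal := Type.

Definition cle (k l : cardinal) : Prop := [set: k] #<= [set: l].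
Definition clt (k l : cardinal) : Prop := cle k l /\ ~ cle l k.

Definition is_least (P : cardinal -> Prop) (k : cardinal) : Prop :=
  P k /\ forall l, P l -> cle k l.

(* The default value [False] is used only when no cardinal satisfies [P], see
   [leastP]. *)
Definition least (P : cardinal -> Prop) : cardinal :=
  if pselect (exists k, is_least P k) is left ex then sval (cid ex) else False.

Definition csup (I : Type) (K : I -> cardinal) : cardinal :=
  least (fun k => forall i, cle (K i) k).

Definition cmin (I : Type) (K : I -> cardinal) : cardinal :=
  least (fun k => exists i, k = K i).

(* k ^ (< l) = sup {k ^ m : m < l}, where [m -> k] is the power k ^ m *)
Definition cpow_lt (k l : cardinal) : cardinal :=
  csup (fun m : {m : cardinal | clt m l} => sval m -> k).

Lemma cle_inj (k l : cardinal) (f : k -> l) : injective f -> cle k l.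
Proof.
move=> f_inj; have : $|{injfun [set: k] >-> [set: l]}|.
  by apply/injfunPex; exists f => // x y _ _; exact: f_inj.
by case=> g; exact: (inj_card_le g).
Qed.

Lemma cleP (k l : cardinal) : cle k l <-> exists f : k -> l, injective f.
Proof.
split=> [/card_leP[f]|[f]]; last exact: cle_inj.
exists (fun x => \val (f (SigSub (mem_set (I : [set: k] x))))) => x y /val_inj.
by move=> /(@inj _ _ _ f); rewrite !inE => /(_ I I) /(congr1 val).
Qed.

Lemma cle_trans (l k m : cardinal) : cle k l -> cle l m -> cle k m.
Proof. exact: card_le_trans. Qed.

Section well_foundedness.
Variables (I : Type) (K : I -> cardinal).

(* partial simultaneous injections between all the [K i] *)
Let matching (F : set (forall i, K i)) :=
  forall f g, F f -> F g -> forall i, f i = g i -> f = g.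

Lemma least_family : I -> exists i, forall j, cle (K i) (K j).
Proof.
move=> i0.
have [|F [mF maxF]] := @Zorn_bigcup _ matching.
  move=> G GP Gtot f g [A GA Af] [A' GA' A'g] i.
  have [sub|sub] := Gtot _ _ GA GA'.
    by apply: (GP _ GA') => //; exact: sub.
  by apply: (GP _ GA) => //; exact: sub.
have [[i iF]|noi] := pselect (exists i, forall x, exists2 f, F f & f i = x).
  exists i => j; apply/cleP.
  have [h hP] : {h : K i -> forall i, K i & forall x, F (h x) /\ h x i = x}.
    by apply: (@choice _ _ (fun x f => F f /\ f i = x)) => x; have [f] := iF x; exists f.
  exists (fun x => h x j) => x y hxy.
  rewrite -(hP x).2 -(hP y).2; congr (_ i).
  exact: mF (hP x).1 (hP y).1 _ hxy.
have ex i : {x : K i | forall f, F f -> f i <> x}.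
  apply: cid; apply: contrapT => /forallNP nx; apply: noi; exists i => x.
  apply: contrapT => xF; apply: (nx x) => f Ff fx.
  by apply: xF; exists f.
pose g i := sval (ex i); have gP i f : F f -> f i <> g i by exact: (svalP (ex i)).
exfalso; apply: (maxF (F `|` [set g])).
  split=> [|/(_ g (or_intror erefl)) Fg]; first exact: subsetUl.
  exact: (gP i0 g Fg).
move=> f f' [Ff|->] [Ff'|->] i // eqi; first exact: mF eqi.
- by have := gP _ _ Ff eqi.
- by have := gP _ _ Ff' (esym eqi).
Qed.

End well_foundedness.

Lemma leastP (P : cardinal -> Prop) (k : cardinal) : P k -> is_least P (least P).
Proof.
move=> Pk; rewrite /least; case: pselect => [ex|[]]; first exact: svalP (cid ex).
pose Q (A : set k) := exists l, [/\ P l, cle A l & cle l A].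
have QT : Q [set: k].
  exists k; split=> //; first by apply: (@cle_inj _ _ val); exact: val_inj.
  by apply: (@cle_inj _ _ (fun x => SigSub (mem_set (I : [set: k] x)))) => x y [].
have [[A [l [Pl Al lA]]] /= minA] :=
  @least_family {A : set k | Q A} (fun A => sval A) (exist _ _ QT).
exists l; split=> // m Pm.
have Ak : cle A k by apply: (@cle_inj _ _ val); exact: val_inj.
have [mk|Nmk] := pselect (cle m k); last first.
  have [[] /= H] := @least_family bool (fun b => if b then k else m) true.
    exact: cle_trans lA (cle_trans Ak (H false)).
  by case: Nmk; exact: (H true).
have /cleP[f f_inj] := mk.
have fm : cle m (range f).
  apply: (@cle_inj _ _ (fun x => SigSub (mem_set (imageT f x)))) => x y [].
  exact: f_inj.
have mf : cle (range f) m.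
  have [h hP] : {h : range f -> m & forall x, f (h x) = \val x}.
    apply: (@choice _ _ (fun x y => f y = \val x)) => -[x /=].
    by rewrite inE => -[y _ <-]; exists y.
  apply: (@cle_inj _ _ h) => x y /(congr1 f); rewrite !hP; exact: val_inj.
have Qf : Q (range f) by exists m.
exact: cle_trans lA (cle_trans (minA (exist _ _ Qf)) mf).
Qed.

Lemma csupP (I : Type) (K : I -> cardinal) (b : cardinal) :
  (forall i, cle (K i) b) ->
  (forall i, cle (K i) (csup K)) /\
  (forall k, (forall i, cle (K i) k) -> cle (csup K) k).
Proof. exact: leastP. Qed.

Lemma cminP (I : Type) (K : I -> cardinal) (i0 : I) :
  (exists i, cmin K = K i) /\ forall i, cle (cmin K) (K i).
Proof.
have [] := @leastP (fun k => exists i, k = K i) (K i0) (ex_intro _ i0 erefl).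
by move=> ? minK; split=> // i; apply: minK; exists i.
Qed.

Definition open_cover (Y : topologicalType) (U : set (set Y)) : Prop :=
  U `<=` open /\ \bigcup_(V in U) V = [set: Y].

Definition delta (Y : topologicalType) : cardinal :=
  (nat + least (fun m => forall U : set (set Y), open_cover U ->
    exists W : set (set Y), [/\ W `<=` U, open_cover W & clt W m]))%type.

Definition cellular_family (Y : topologicalType) (F : set (set Y)) : Prop :=
  (forall U, F U -> open U /\ U !=set0) /\ trivIset F id.

Definition cellularity (Y : topologicalType) : cardinal :=
  (nat + csup (fun F : {F : set (set Y) | cellular_family F} => sval F))%type.

Definition density (Y : topologicalType) : cardinal :=
  (nat + cmin (fun D : {D : set Y | dense D} => sval D))%type.

(* Closure under finite unions includes the empty union; this only matters for
   an empty [X], where it excludes the empty family. *)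
Record bornology (X : Type) := Bornology {
  bounded :> set (set X) ;
  bounded_sub : forall A A', bounded A -> A' `<=` A -> bounded A' ;
  bounded_bigcup : forall F : set (set X), finite_set F -> F `<=` bounded ->
    bounded (\bigcup_(A in F) A) ;
  bounded_cover : \bigcup_(A in bounded) A = [set: X]
}.

Section bornology_theory.
Variables (X : Type) (B : bornology X).

Lemma bounded0 : bounded B set0.
Proof. by rewrite -(bigcup_set0 id); apply: bounded_bigcup. Qed.

Lemma boundedU A A' : bounded B A -> bounded B A' -> bounded B (A `|` A').
Proof.
move=> BA BA'; rewrite -(bigcup_set1 id A) -(bigcup_set1 id A') -bigcup_setU.
by apply: bounded_bigcup => [|_ [->|->]//]; rewrite finite_setU.
Qed.

Definition is_base (B0 : set (set X)) : Prop :=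
  B0 `<=` bounded B /\
  forall A, bounded B A -> exists2 A0, B0 A0 & A `<=` A0.

Definition cf : cardinal :=
  (nat + cmin (fun B0 : {B0 : set (set X) | is_base B0} => sval B0))%type.

End bornology_theory.

Definition has_closed_base (X : topologicalType) (B : bornology X) : Prop :=
  exists2 B0 : set (set X), is_base B B0 & B0 `<=` closed.

Definition bornology_delta (X : topologicalType) (B : bornology X) : cardinal :=
  csup (fun A : {A : set X | bounded B A} => delta (closure (sval A))).

(* C(X) endowed with the topology tau_B. The alias hides the default topology
   of [continuousType X R]. *)
Definition C_tau (R : realType) (X : topologicalType) (B : bornology X) : Type :=
  continuousType X R.

Section tau.
Variables (R : realType) (X : topologicalType) (B : bornology X).

HB.instance Definition _ := Choice.copy (C_tau R B) (continuousType X R).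

Definition basic_ent (A : set X) (e : R) : set (C_tau R B * C_tau R B) :=
  [set fg | forall x, A x -> `|(fg.1 : continuousType X R) x -
                               (fg.2 : continuousType X R) x| < e].

Definition tau_ent : set_system (C_tau R B * C_tau R B) :=
  filter_from [set p : set X * R | bounded B p.1 /\ 0 < p.2]
    (fun p => basic_ent p.1 p.2).

Let tau_ent_filter : Filter tau_ent.
Proof.
apply: filter_from_filter; first by exists (set0, 1); split=> //; exact: bounded0.
move=> [A e] [A' e'] [/= BA e0] [/= BA' e'0].
exists (A `|` A', Num.min e e') => /=; first split=> /=.
- exact: boundedU.
- by rewrite lt_min e0.
move=> fg fgP; split=> x Ax; (have := fgP x); rewrite lt_min.
- by case/(_ (or_introl Ax))/andP.
- by case/(_ (or_intror Ax))/andP.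
Qed.

Let tau_ent_diagonal E : tau_ent E -> diagonal `<=` E.
Proof.
move=> [[A e] [_ /= e0] sE] [f g] /= fg; apply: sE => x _ /=.
by rewrite (_ : f = g) ?subrr ?normr0.
Qed.

Let tau_ent_inv E : tau_ent E -> tau_ent E^-1%relation.
Proof.
move=> [[A e] Ae sE]; exists (A, e) => // -[f g] /= fg; apply: sE => x Ax /=.
by rewrite distrC; exact: fg.
Qed.

Let tau_ent_split E :
  tau_ent E -> exists2 E', tau_ent E' & (E' \; E')%relation `<=` E.
Proof.
move=> [[A e] [/= BA e0] sE]; exists (basic_ent A (e / 2)).
  by exists (A, e / 2) => //; split=> //=; rewrite divr_gt0.
move=> [f g] [h /= fh hg]; apply: sE => x Ax /=.
have := ler_distD ((h : continuousType X R) x) ((f : continuousType X R) x)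
  ((g : continuousType X R) x).
move/le_lt_trans; apply; rewrite (splitr e).
by rewrite ltrD// ?(fh x)// ?(hg x).
Qed.

HB.instance Definition _ := isUniform.Build (C_tau R B)
  tau_ent_filter tau_ent_diagonal tau_ent_inv tau_ent_split.

End tau.

(* Main.v *)
(* A metric space in which some open cover of a closed set Y has no subcover of
   cardinality < m contains a locally finite subset of Y of cardinality m, and
   no locally finite subset of Y reaches the cardinality delta(Y).

   For the lower bound, the subsets of a locally finite set T have continuous
   indicators, so that T yields 2^|T| disjoint open sets.

   For the upper bound, fix A in the bornology and e > 0. Continuous functions
   are mapped to codes that determine them up to e on A, and one function per
   code is kept. For some n, the points y of A around which f oscillates by e
   at scale 1/n have a dense subset of cardinality < delta, since otherwise
   large separated sets of such points, for all n, would unite into a locally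
   finite set of cardinality delta. The code of f consists of n, of the values
   of f up to e at the points of a maximal 1/(2n)-separated subset of A around
   which f oscillates little, and of its values up to e on a dense subset, which
   depends only on the former data, of the remaining part of A. *)
Require Import Defs.
From mathcomp Require Import all_boot all_order all_algebra.
From mathcomp Require Import all_classical all_reals.
From mathcomp Require Import topology normedtype.
From mathcomp Require Import interval_inference lra.

Set Implicit Arguments.
Unset Strict Implicit.
Unset Printing Implicit Defensive.

Import Order.TTheory GRing.Theory Num.Theory.
Import numFieldNormedType.Exports.

Local Open Scope classical_set_scope.
Local Open Scope ring_scope.

(** * Cardinals *)

Section cardinals.
Local Open Scope type_scope.
Implicit Types k l m : cardinal.

Lemma cle_refl k : cle k k.
Proof. exact: (@cle_inj _ _ id). Qed.

Lemma cle_total k l : cle k l \/ cle l k.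
Proof.
have [[] /= H] := @least_family bool (fun b => if b then k else l) true.
  by left; exact: (H false).
by right; exact: (H true).
Qed.

Lemma cleNge k l : ~ cle k l -> cle l k.
Proof. by case: (cle_total k l). Qed.

Lemma cle_clt_trans l k m : cle k l -> clt l m -> clt k m.
Proof.
move=> kl [lm Nml]; split; first exact: cle_trans lm.
by move=> mk; apply: Nml; exact: cle_trans kl.
Qed.

Lemma clt_cle_trans l k m : clt k l -> cle l m -> clt k m.
Proof.
move=> [kl Nlk] lm; split; first exact: cle_trans lm.
by move=> mk; apply: Nlk; exact: cle_trans mk.
Qed.

Lemma cltNge k l : ~ cle l k -> clt k l.
Proof. by move=> Nlk; split=> //; exact: cleNge. Qed.

(** The injection is chosen inside a relation, which spares explicit maps between the sigma types
    that sets coerce to. *)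
Lemma cle_rel k l (G : k -> l -> Prop) :
    (forall x, exists y, G x y) ->
    (forall x x' y, G x y -> G x' y -> x = x') ->
  cle k l.
Proof.
move=> /choice[f fP] Ginj; apply: (@cle_inj _ _ f) => x x' ff.
by apply: (Ginj _ _ (f x)) => //; rewrite ff.
Qed.

Lemma cle_range k l (f : k -> l) : cle (range f) k.
Proof.
apply: (@cle_rel _ _ (fun y x => f x = \val y)) => [[y /= /set_mem[x _ <-]]|].
  by exists x.
by move=> y y' x yx y'x; apply: val_inj; rewrite -yx.
Qed.

Lemma cle_subset (T : Type) (A A' : set T) : A `<=` A' -> cle A A'.
Proof.
move=> sAA'; apply: (@cle_rel A A' (fun x y => \val x = \val y)).
  by move=> [x /= /set_mem /sAA' /mem_set A'x]; exists (SigSub A'x).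
by move=> x x' y xy x'y; apply: val_inj; rewrite xy.
Qed.

Lemma cle_setT (T : Type) (A : set T) : cle A T.
Proof. by apply: (@cle_inj _ _ val); exact: val_inj. Qed.

Lemma cle_prod k k' l l' : cle k k' -> cle l l' -> cle (k * l) (k' * l').
Proof.
move=> /cleP[f f_inj] /cleP[g g_inj].
apply: (@cle_inj _ _ (fun p => (f p.1, g p.2))).
by move=> [a b] [c d] [/f_inj-> /g_inj->].
Qed.

Lemma cle_sum k k' l l' : cle k k' -> cle l l' -> cle (k + l) (k' + l').
Proof.
move=> /cleP[f f_inj] /cleP[g g_inj].
apply: (@cle_inj _ _ (fun s => match s with
  inl x => inl (f x) | inr y => inr (g y) end)).
by move=> [a|b] [c|d] // []; [move/f_inj->|move/g_inj->].
Qed.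

Lemma cle_inr k l : cle l (k + l).
Proof. by apply: (@cle_inj _ _ inr) => x y []. Qed.

Lemma cle_inl k l : cle k (k + l).
Proof. by apply: (@cle_inj _ _ inl) => x y []. Qed.

Lemma cle_pow_bool k l : cle k l -> cle (k -> bool) (l -> bool).
Proof.
move=> /cleP[f f_inj].
apply: (@cle_inj _ _ (fun (A : k -> bool) y => `[< exists2 x, f x = y & A x >])).
move=> A A' AA'.
apply/funext => x; move/(congr1 (fun h => h (f x))): AA' => AA'.
by apply/idP/idP => Ax; [have := AA'|have := esym AA'];
  (rewrite asboolT; last by exists x); move=> /esym /asboolP[x' /f_inj->].
Qed.

Lemma cle_setC (T : Type) (A : set T) : cle T (A + (~` A)%classic).
Proof.
apply: (@cle_rel _ (A + (~` A)%classic)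
  (fun x s => match s with inl y => x = \val y | inr y => x = \val y end)).
  move=> x; have [Ax|NAx] := pselect (A x).
    by exists (inl (SigSub (mem_set Ax))).
  have CAx : (~` A)%classic x by [].
  by exists (inr (SigSub (mem_set CAx))).
by move=> x x' [y|y] -> ->.
Qed.

(** * The square of an infinite cardinal *)

Section square.
Variable k : cardinal.
Hypothesis k_inf : cle nat k.

(* [G] is a multivalued injection of the square of its carrier into it. *)
Let carrier (G : set (k * k * k)) := [set x | exists z, G (x, x, z)].
Let square (G : set (k * k * k)) := [/\
  forall p, G p -> [/\ carrier G p.1.1, carrier G p.1.2 & carrier G p.2],
  forall x y, carrier G x -> carrier G y -> exists z, G (x, y, z) &
  forall p q, G p -> G q -> p.2 = q.2 -> p.1 = q.1].

Lemma square_directed (F : set (set (k * k * k))) (U := \bigcup_(G in F) G) :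
    F `<=` square ->
    (forall p q, U p -> U q -> exists G, [/\ F G, G p & G q]) ->
  square U.
Proof.
move=> Fsq dir.
have sub G : F G -> carrier G `<=` carrier U.
  by move=> FG x [z Gz]; exists z, G.
split=> [p [G FG Gp]|x y [z Uz] [t Ut]|p q Up Uq].
- have [H _ _] := Fsq _ FG; have [? ? ?] := H _ Gp.
  by split; apply: (sub G FG).
- have [G [FG Gz Gt]] := dir _ _ Uz Ut.
  have [_ H _] := Fsq _ FG.
  have [w Gw] := H x y (ex_intro _ z Gz) (ex_intro _ t Gt).
  by exists w, G.
- have [G [FG Gp Gq]] := dir _ _ Up Uq.
  by have [_ _] := Fsq _ FG; exact.
Qed.

Lemma square_nat : exists G, square G /\ cle nat (carrier G).
Proof.
have /cleP[i i_inj] := k_inf.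
pose G := [set p | exists a b : nat, p = (i a, i b, i (pickle (a, b)))].
have cG a : carrier G (i a) by exists (i (pickle (a, a))), a, a.
exists G; split; last first.
  by apply: (@cle_inj _ _ (fun a => SigSub (mem_set (cG a)))) => a b [] /i_inj.
split=> [_ [a [b ->]]|x y [_ [a [_ [-> _ _]]]] [_ [b [_ [-> _ _]]]]|].
- by split; exact: cG.
- by exists (i (pickle (a, b))), a, b.
move=> _ _ [a [b ->]] [c [d ->]] /= /i_inj.
move=> /(congr1 (@unpickle (nat * nat)%type)).
by rewrite !pickleK => -[-> ->].
Qed.

Lemma cle_square_carrier (G : set (k * k * k)) :
  square G -> cle (carrier G * carrier G) (carrier G).
Proof.
move=> [Gc Gt Gi].
apply: (@cle_rel _ _ (fun p z => G (\val p.1, \val p.2, \val z))).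
  move=> [[x /= /set_mem cx] [y /= /set_mem cy]].
  have [z Gz] := Gt _ _ cx cy; have [_ _ cz] := Gc _ Gz.
  by exists (SigSub (mem_set cz)).
move=> [x y] [x' y'] z /= Gz Gz'.
by have [/val_inj -> /val_inj ->] := Gi _ _ Gz Gz' erefl.
Qed.

Lemma cle_double l : cle bool l -> cle (l * l) l -> cle (l + l) l.
Proof.
move=> /cleP[b b_inj] ll; apply: cle_trans ll.
apply: (@cle_inj _ _ (fun s => match s with
  inl x => (b true, x) | inr x => (b false, x) end)).
by move=> [x|x] [y|y] [] => [->|/b_inj|/b_inj|->].
Qed.

(** Zorn's lemma gives a maximal [G] with carrier [A]. If the complement of [A] embeds in [A], then
    so does [k], and [A * A] embeds in [A]; otherwise a copy of [A] in the complement leaves room to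
    extend [G]. *)
Lemma cle_square : cle (k * k) k.
Proof.
have [G0 [G0sq G0nat]] := square_nat.
pose P G := G = set0 \/ square G /\ G0 `<=` G.
have [|G [PG maxG]] := @Zorn_bigcup _ P.
  move=> F FP Ftot.
  have [[G1 FG1 G1n0]|F0] := pselect (exists2 G1, F G1 & G1 <> set0); last first.
    left; rewrite -subset0 => p [G FG Gp]; apply: F0; exists G => // G0'.
    by rewrite G0' in Gp.
  right; split; last first.
    have [//|[_ sub]] := FP _ FG1.
    by apply: subset_trans sub _ => p Gp; exists G1.
  have -> : \bigcup_(G in F) G = \bigcup_(G in F `&` square) G.
    apply/seteqP; split=> p [G FG Gp]; last by exists G => //; case: FG.
    exists G => //; split=> //; have [G0'|[]//] := FP _ FG.
    by rewrite G0' in Gp.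
  apply: square_directed => [G []//|p q [G [FG Gsq] Gp] [G' [FG' Gsq'] Gq]].
  by have [s|s] := Ftot _ _ FG FG'; [exists G'|exists G]; split=> //; exact: s.
have [G_0|[Gsq sub]] := PG.
  exfalso; apply: (maxG G0); last by right; split.
  rewrite G_0; split=> // G0s; have /cleP[i _] := G0nat.
  by have [x /= /set_mem[z /G0s]] := i 0%N.
set A := carrier G in Gsq.
have AA : cle (A * A) A by exact: cle_square_carrier.
have natA : cle nat A.
  apply: cle_trans G0nat _; apply: cle_subset => x [z G0z].
  by exists z; exact: sub.
have boolA : cle bool A.
  by apply: cle_trans natA; apply: (@cle_inj _ _ nat_of_bool) => -[] [].
have A2 : cle (A + A) A := cle_double boolA AA.
have [CA|/cleNge/cleP[j j_inj]] := pselect (cle (~` A)%classic A).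
  have kA : cle k A.
    exact: cle_trans (cle_trans (cle_setC A) (cle_sum (cle_refl A) CA)) A2.
  apply: cle_trans (cle_trans AA (cle_setT A)).
  exact: cle_prod.
(* Otherwise [A] has a disjoint copy [A'], and the pairs of [A `|` A'] that
   are not in [A * A] can be sent into [A']. *)
pose A' := range (val \o j).
have A'NA x : A' x -> ~ A x by move=> [a _ <-]; exact: (set_mem (valP (j a))).
pose S := A `|` A'.
have SA : cle S A.
  apply: cle_trans A2.
  apply: (@cle_rel _ _ (fun x s => match s with
    inl y => \val x = \val y | inr y => \val x = \val (j y) end)).
    move=> [x /= /set_mem[Ax|[y _ <-]]]; last by exists (inr y).
    by exists (inl (SigSub (mem_set Ax))).
  by move=> x x' [y|y] xy x'y; apply: val_inj; rewrite xy.
have /cleP[h h_inj] : cle (S * S) A := cle_trans (cle_prod SA SA) AA.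
pose psi p := \val (j (h p)).
have psi_inj : injective psi by move=> p q /val_inj /j_inj /h_inj.
pose N := [set p : k * k * k | exists x y : S,
  [/\ ~ (A (\val x) /\ A (\val y)), p.1 = (\val x, \val y) & p.2 = psi (x, y)]].
have psiA' p : A' (psi p) by exists (h p).
have /cleP[f _] := natA; pose a0 := f 0%N.
exfalso; apply: (maxG (G `|` N)).
  split; first by move=> p; left.
  have Sa : S (\val (j a0)) by right; exists a0.
  have NAja : ~ A (\val (j a0)) by apply: A'NA; exists a0.
  pose s : S := SigSub (mem_set Sa).
  move=> /(_ (\val s, \val s, psi (s, s))) sG; have [Gc _ _] := Gsq.
  have /sG/Gc[+ _ _] : (G `|` N) (\val s, \val s, psi (s, s)).
    by right; exists s, s; split=> // -[].
  exact: NAja.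
right; split; last by move=> p /sub; left.
have cS : carrier (G `|` N) = S.
  apply/seteqP; split=> x.
    move=> [z [Gz|[y [y' [_ [-> _] _]]]]]; first by left; exists z.
    exact/set_mem/(valP y).
  move=> Sx; have [[z Gz]|NAx] := pselect (A x); first by exists z; left.
  pose s : S := SigSub (mem_set Sx).
  by exists (psi (s, s)); right; exists s, s; split=> // -[].
have [Gc Gt Gi] := Gsq.
split.
- rewrite cS => p [/Gc[? ? ?]|[x [y [_ -> ->]]]]; first by split; left.
  by split; [exact/set_mem/(valP x)|exact/set_mem/(valP y)|right].
- rewrite cS => x y Sx Sy; have [[Ax Ay]|NA] := pselect (A x /\ A y).
    by have [z Gz] := Gt _ _ Ax Ay; exists z; left.
  exists (psi (SigSub (mem_set Sx), SigSub (mem_set Sy))); right.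
  by exists (SigSub (mem_set Sx)), (SigSub (mem_set Sy)).
- move=> p q [Gp|[x [y [xy -> ->]]]] [Gq|[x' [y' [xy' -> ->]]]].
  + exact: Gi.
  + by move=> e; have [_ _] := Gc _ Gp; rewrite e => /(A'NA _ (psiA' _)).
  + by move=> e; have [_ _] := Gc _ Gq; rewrite -e => /(A'NA _ (psiA' _)).
  + by move=> /psi_inj[-> ->].
Qed.

End square.

(** * Powers with an exponent below a given cardinal *)

Lemma cantor k : ~ cle (k -> bool) k.
Proof.
move=> /cleP[f f_inj].
pose D x := `[< exists2 A, f A = x & ~~ A x >].
have [DfD|NDfD] := boolP (D (f D)).
  by have /asboolP[A /f_inj -> /negP] := DfD; apply.
by case/negP: (NDfD); apply/asboolP; exists D.
Qed.

Lemma cle_add k l : cle nat l -> cle k l -> cle (nat + k) l.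
Proof.
move=> nat_l kl; apply: cle_trans (cle_sum nat_l kl) _.
apply: cle_double (cle_square nat_l); apply: cle_trans nat_l.
by apply: (@cle_inj _ _ nat_of_bool) => -[] [].
Qed.

Lemma cle_mul k k' l : cle nat l -> cle k l -> cle k' l -> cle (k * k') l.
Proof.
by move=> nat_l kl k'l; exact: cle_trans (cle_prod kl k'l) (cle_square nat_l).
Qed.

Lemma cle_cpow_lt k l : clt k l -> cle (k -> bool) (cpow_lt bool l).
Proof.
move=> kl; apply: ((@csupP _ _ (l -> bool) _).1 (exist _ k kl)) => -[m [ml _]] /=.
exact: cle_pow_bool.
Qed.

(** A supremum below [nat] would be below [l], hence would bound its own power, against Cantor's
    theorem. *)
Lemma cle_nat_cpow_lt l : cle nat l -> cle nat (cpow_lt bool l).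
Proof.
move=> nat_l; apply: contrapT => /cltNge Pfin.
apply: (@cantor (cpow_lt bool l)); apply: cle_cpow_lt.
exact: clt_cle_trans nat_l.
Qed.

Lemma cle_fun_nat_finite k : clt k nat -> cle (k -> nat) nat.
Proof.
move=> [_ Nnat_k]; have /finite_set_leP[n] : finite_set [set: k].
  by apply: contrapT => /infiniteP.
move=> /card_leP[g].
pose h x : nat := \val (g (SigSub (mem_set (I : [set: k] x)))).
have h_inj : injective h.
  move=> x y /val_inj /(@inj _ _ _ g); rewrite !inE => /(_ I I).
  by move=> /(congr1 val).
have hn x : (h x < n)%N by exact: (set_mem (valP (g _))).
pose value (f : k -> nat) i :=
  if pselect (exists x, h x = i) is left ex then f (sval (cid ex)) else 0%N.
have valueE f x : value f (h x) = f x.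
  rewrite /value; case: pselect => [ex|[]]; last by exists x.
  by congr f; apply: h_inj; case: cid.
apply: (@cle_inj _ _ (fun f => pickle (mkseq (value f) n))) => f f'.
move=> /(congr1 (@unpickle (seq nat))); rewrite !pickleK => -[ff'].
apply/funext => x; rewrite -(valueE f) -(valueE f').
rewrite -(nth_mkseq 0%N (value f) (hn x)).
by rewrite ff' nth_mkseq.
Qed.

(** For infinite [k], a function is determined by its graph, a subset of [k * nat], and [k * nat]
    embeds in [k]. *)
Lemma cle_fun_nat k l : cle nat l -> clt k l ->
  cle (k -> nat) (cpow_lt bool l).
Proof.
move=> nat_l kl; have [nat_k|/cltNge k_nat] := pselect (cle nat k); last first.
  exact: cle_trans (cle_fun_nat_finite k_nat) (cle_nat_cpow_lt nat_l).
apply: cle_trans (cle_cpow_lt kl).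
apply: cle_trans (cle_pow_bool (cle_mul nat_k (cle_refl k) nat_k)).
apply: (@cle_inj _ _ (fun f p => f p.1 == p.2)) => f g fg.
apply/funext => x; apply/eqP; rewrite eq_sym.
by move/(congr1 (fun h => h (x, f x))): fg => /= <-.
Qed.

End cardinals.

Lemma csup_le (I : Type) (K : I -> cardinal) (k : cardinal) :
  (forall i, cle (K i) k) -> cle (csup K) k.
Proof. by move=> Kk; exact: (csupP Kk).2. Qed.

Lemma cle_set (k m : cardinal) : cle k m -> cle (set k) (set m).
Proof.
move=> /cleP[f f_inj]; apply: (@cle_inj _ _ (fun A => f @` A)) => A A' AA'.
by apply/funext => x; rewrite -(image_inj f_inj) AA' (image_inj f_inj).
Qed.

Lemma cle_bigcup (T : Type) (F : nat -> set T) (k : cardinal) :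
  (forall n, cle (F n) k) -> cle (\bigcup_n F n) (nat * k)%type.
Proof.
move=> Fk.
have /all_sig[i i_inj] : forall n, {i : F n -> k | injective i}.
  by move=> n; apply/cid/cleP.
apply: (@cle_rel _ (nat * k)%type
  (fun x p => exists2 t : F p.1, val t = val x & i p.1 t = p.2)).
  move=> [x /= /set_mem[n _ Fnx]]; pose t : F n := SigSub (mem_set Fnx).
  by exists (n, i n t), t.
move=> x x' [n y] [/= t tx ty] [/= t' tx' ty']; apply: val_inj.
have tt' : t = t' by apply: (i_inj n); rewrite ty.
by rewrite -[LHS]tx -[RHS]tx' tt'.
Qed.

Lemma cle_setE (k : cardinal) (T : Type) (A : set T) :
  cle k A = ([set: k] #<= A)%card.
Proof. by rewrite /cle (card_le_eqr (card_setT A)). Qed.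

Lemma cle_injective_image (T : Type) (f : nat -> T) (n : nat) (k : cardinal) :
  injective f -> cle (f @` `I_n.+1) k -> ~ cle k `I_n.
Proof.
move=> f_inj fk kn; have := cle_trans fk kn.
rewrite cle_setE (card_le_eql (card_setT _)).
rewrite (card_le_eql (inj_card_eq (in2W f_inj))).
by rewrite card_le_II ltnn.
Qed.

Lemma natSinv_lt (R : realType) (e : R) : 0 < e -> exists n, n.+1%:R^-1 < e.
Proof.
move=> e0; have [n _ /(_ _ (leqnn n)) ne] := near_infty_natSinv_lt (PosNum e0).
by exists n.
Qed.

(** The code of a real is the integer part of its quotient by [e]. Counting functions up to [e] thus
    becomes counting functions into [nat]. *)
Lemma nat_quantization (R : realType) (e : R) : 0 < e ->
  exists q : R -> nat, forall a b, q a = q b -> `|a - b| < e.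
Proof.
move=> e0; exists (fun a => pickle (Num.floor (a / e))) => a b.
move=> /(congr1 (@unpickle int)); rewrite !pickleK => -[ab].
have := floor_itv (b / e); have := floor_itv (a / e); rewrite ab intrD.
set n := _%:~R => /andP[na an] /andP[nb bn].
have : `|a / e - b / e| < 1 by rewrite ltr_norml; lra.
rewrite -mulrBl normrM (gtr0_norm (x := e^-1)) ?invr_gt0//.
by rewrite ltr_pdivrMr// mul1r.
Qed.

(** * Open covers and locally finite sets *)

Definition small_covers (Y : topologicalType) (m : cardinal) : Prop :=
  forall U : set (set Y), open_cover U ->
    exists W : set (set Y), [/\ W `<=` U, open_cover W & clt W m].

(** A cover is a set of subsets of [Y], so Cantor's theorem makes it smaller than [m]. Hence the
    [least] in [delta] does not take its default value. *)
Lemma small_covers_set (Y : topologicalType) (m : cardinal) :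
  cle (set (set Y)) m -> small_covers Y m.
Proof.
move=> Ym U Uc; exists U; split=> //; apply: clt_cle_trans Ym.
apply: (@cle_clt_trans (set Y)); first exact: cle_setT.
apply: cltNge => YY; apply: (@cantor (set Y)); apply: cle_trans YY.
apply: (@cle_inj _ _ (fun A : set Y -> bool => [set y | A y])).
move=> A A' /seteqP[sAA' sA'A].
by apply/funext => y; apply/idP/idP; [exact: sAA'|exact: sA'A].
Qed.

Lemma deltaP (Y : topologicalType) :
  exists2 L : cardinal, delta Y = (nat + L)%type & is_least (small_covers Y) L.
Proof.
exists (least (small_covers Y)) => //.
exact: (leastP (small_covers_set (cle_refl _))).
Qed.

Lemma delta_le (Y : topologicalType) (m : cardinal) :
  cle nat m -> small_covers Y m -> cle (delta Y) m.
Proof.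
by move=> nat_m Ym; have [L -> [_ /(_ _ Ym)]] := deltaP Y; exact: cle_add.
Qed.

Section locally_finite.
Variable X : topologicalType.
Implicit Types T S : set X.

Definition locally_finite T :=
  forall x : X, exists2 N, nbhs x N & finite_set (T `&` N).

Lemma locally_finiteS T S : S `<=` T -> locally_finite T -> locally_finite S.
Proof.
move=> ST Tlf x; have [N Nx TN] := Tlf x; exists N => //.
by apply: sub_finite_set TN; exact: setSI.
Qed.

Lemma locally_finite_subsingleton T :
    (forall x : X, exists2 N, nbhs x N &
      forall y z, T y -> N y -> T z -> N z -> y = z) ->
  locally_finite T.
Proof.
move=> TN x; have [N Nx Nsub] := TN x; exists N => //.
have [[y [Ty Ny]]|N0] := pselect (exists y, (T `&` N) y); last first.
  rewrite (_ : _ `&` _ = set0); first exact: finite_set0.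
  by rewrite -subset0 => y TNy; apply: N0; exists y.
by apply: (sub_finite_set _ (finite_set1 y)) => z [Tz Nz]; exact: Nsub.
Qed.

Hypothesis X_T1 : accessible_space X.

Lemma locally_finite_closed T : locally_finite T -> closed T.
Proof.
move=> Tlf x clTx; apply: contrapT => NTx.
have [N Nx TN] := Tlf x.
have : nbhs x (N `&` ~` (T `&` N)).
  apply: filterI => //; apply: open_nbhs_nbhs; split; last by case.
  by rewrite openC; exact: (accessible_finite_set_closed.1 X_T1).
by move=> /clTx[y [Ty [Ny]]]; apply.
Qed.

(** [Y] is covered by the complements of [T] minus one point, open because subsets of [T] are
    closed. Each contains at most one point of [T], so a subcover has at least as many members as
    [T] has points. *)
Lemma clt_locally_finite (Y T : set X) :
  T `<=` Y -> locally_finite T -> clt T (delta Y).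
Proof.
move=> TY Tlf; have [L -> [Lcov _]] := deltaP Y.
apply: (clt_cle_trans _ (cle_inr nat L)).
pose V x : set Y := val @^-1` (~` (T `\ x)).
have [|W [WV [_ WY] WL]] := Lcov [set V (val x) | x in [set: Y]].
  split=> [_ [x _ <-]|].
    exists (~` (T `\ val x)) => //; apply: closed_openC.
    apply: locally_finite_closed; apply: locally_finiteS Tlf.
    exact: subDsetl.
  rewrite -subTset => x _; exists (V (val x)); first by exists x.
  by case=> _; apply.
apply: cle_clt_trans WL.
apply: (@cle_rel T W (fun t w =>
  exists2 y : Y, val y = val t & (val w : set Y) y)).
  move=> [t /= tT]; have := TY _ (set_mem tT) => /mem_set tY.
  have : [set: Y] (SigSub tY) by [].
  rewrite -WY => -[w Ww wt]; exists (SigSub (mem_set Ww)).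
  by exists (SigSub tY).
move=> t t' [w /= wW] [y yt wy] [y' yt' wy'].
have [x _ Vw] := WV _ (set_mem wW).
move: wy wy'; rewrite -Vw /V /= yt yt' => Vt Vt'; apply: val_inj.
have tx (s : T) : T (val s) -> ~ (T `\ val x) (val s) -> val s = val x :> X.
  by move=> Ts NTs; apply: contrapT => sx; apply: NTs.
by rewrite (tx t (set_mem (valP t)) Vt) (tx t' (set_mem (valP t')) Vt').
Qed.

End locally_finite.

Lemma maximal_independent (T : Type) (r : T -> T -> Prop) (Y : set T) :
    (forall x y, r x y -> r y x) ->
  exists D : set T, [/\ D `<=` Y, forall x y, D x -> D y -> r x y -> x = y &
    forall y, Y y -> D y \/ exists2 x, D x & r x y].
Proof.
move=> r_sym.
pose P D := D `<=` Y /\ forall x y, D x -> D y -> r x y -> x = y.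
have [F FP Ftot|D [[DY Dr] maxD]] := @Zorn_bigcup _ P.
  split=> [x [D FD]|x y [D FD Dx] [D' FD' D'y]]; first exact: (FP _ FD).1.
  have [DD'|D'D] := Ftot _ _ FD FD'.
    by apply: (FP _ FD').2 => //; exact: DD'.
  by apply: (FP _ FD).2 => //; exact: D'D.
exists D; split=> // y Yy; apply: contrapT => /not_orP[NDy Nr].
apply: (maxD (D `|` [set y])).
  by split=> [|/(_ y (or_intror erefl))//]; exact: subsetUl.
split=> [x [/DY//|->//]|x z [Dx|->] [Dz|->] //]; first exact: Dr.
  by move=> rxy; case: Nr; exists x.
by move=> /r_sym ryz; case: Nr; exists z.
Qed.

Section metric.
Variables (R : realType) (X : metricType R).
Implicit Types (x y z : X) (A T Y : set X).

Lemma mdist_lt_trans x y z (a b : R) :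
  mdist x y < a -> mdist y z < b -> mdist x z < a + b.
Proof.
by move=> xy yz; apply: le_lt_trans (metric_triangle x y z) _; exact: ltrD.
Qed.

Lemma metric_accessible : accessible_space X.
Proof. exact: hausdorff_accessible (@metric_hausdorff _ X). Qed.

(* A maximal set of points that are far apart relatively to the size of the
   members of the cover around them is locally finite, and picking a large
   enough member of the cover around each of them yields a subcover. *)
Lemma locally_finite_large Y (m : cardinal) :
    closed Y -> ~ small_covers Y m ->
  exists T, [/\ T `<=` Y, locally_finite T & cle m T].
Proof.
move=> Ycl /existsNP[U /not_implyP[[Uop UY] NU]].
(* [r] is a radius around [x] within which [Y] stays in [V]; the bound 1 makes the supremum of these
   radii finite. *)
pose P x (r : R) V := [/\ 0 < r, r <= 1, U V &
  forall z : Y, mdist x (val z) < r -> V z].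
have exP (y : Y) : exists r V, P (val y) r V.
  have : [set: Y] y by []. rewrite -UY => -[V UV Vy].
  have [W Wop VW] := Uop _ UV.
  have /nbhs_ballP[r /= r0 rW] : nbhs (val y) W.
    by apply: open_nbhs_nbhs; split=> //; rewrite -VW in Vy.
  exists (Num.min r 1), V; split=> //.
  - by rewrite lt_min r0 ltr01.
  - by rewrite ge_min lexx orbT.
  - move=> z; rewrite lt_min => /andP[yz _]; rewrite -VW; apply: rW.
    by rewrite ballEmdist.
have shrink x y r V s : P x r V -> mdist x y + s <= r -> 0 < s -> P y s V.
  move=> [r0 r1 UV rV] xys s0; split=> //.
    by apply: le_trans r1; apply: le_trans xys; rewrite lerDr mdist_ge0.
  move=> z yz; apply: rV; apply: lt_le_trans xys.
  by apply: le_lt_trans (metric_triangle x y _) _; rewrite ltrD2l.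
pose close x y := exists r V, mdist x y < r / 4 /\ (P x r V \/ P y r V).
have [x y [r [V [xy Pxy]]]|T [TY Tclose Tmax]] := @maximal_independent _ close Y.
  by exists r, V; rewrite metric_sym; split=> //; apply/or_comm.
(* [V x] comes with a radius exceeding half of every admissible radius at [x]. *)
have [/= V V_] : {V : X -> set Y & forall x, Y x -> exists r,
    P x r (V x) /\ forall r' V', P x r' V' -> r' < 2 * r}.
  apply: (@choice _ _ (fun x V => Y x -> exists r,
    P x r V /\ forall r' V', P x r' V' -> r' < 2 * r)) => x.
  have [Yx|NYx] := pselect (Y x); last by exists set0.
  pose E := [set r | exists V, P x r V].
  have [r0 [V0 PV0]] := exP (SigSub (mem_set Yx)).
  have supE : has_sup E.
    by split; [exists r0, V0|exists 1 => r [V []]].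
  have r0E : r0 <= sup E by apply: sup_upper_bound => //; exists V0.
  have sup0 : 0 < sup E by apply: lt_le_trans r0E; case: PV0.
  have [r [V PV] supr] := sup_adherent (divr_gt0 sup0 (ltr0Sn _ 1)) supE.
  exists V => _; exists r; split=> // r' V' PV'.
  have : r' <= sup E by apply: sup_upper_bound => //; exists V'.
  by lra.
exists T; split=> //.
  apply: locally_finite_subsingleton => x.
  have [Yx|NYx] := pselect (Y x); last first.
    exists (~` Y) => [|y z /TY//].
    by apply: open_nbhs_nbhs; split=> //; exact: closed_openC.
  have [r [W PW]] := exP (SigSub (mem_set Yx)).
  have r0 : 0 < r by case: PW.
  (* Two points of [Y] in this ball are at distance less than [r / 8], a quarter of the radius
     [r / 2] that [W] still admits around either of them. *)
  exists (ball x (r / 16)) => [|y z]; first by apply: nbhsx_ballx; lra.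
  rewrite ballEmdist /= => Ty xy Tz xz; apply: Tclose => //.
  exists (r / 2), W; split.
    by rewrite metric_sym in xy; have := mdist_lt_trans xy xz; lra.
  by left; apply: shrink PW _ _; [rewrite /=; lra|lra].
apply: contrapT => NmT; apply: NU; exists (V @` T); split.
- by move=> _ [x /TY/V_[r [[_ _ UV _] _]] <-].
- split; first by move=> _ [x /TY/V_[r [[_ _ UV _] _]] <-]; exact: Uop.
  rewrite -subTset => y _.
  have Yy : Y (val y) := set_mem (valP y).
  suff [x Tx Vxy] : exists2 x, T x & V x y by exists (V x) => //; exists x.
  have [Ty|[x Tx [r [W [xy Pxy]]]]] := Tmax _ Yy.
    exists (val y) => //; have [r [[r0 _ _ rV] _]] := V_ _ Yy.
    by apply: rV; rewrite mdistxx.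
  exists x => //; have [s [[s0 _ _ sV] smax]] := V_ _ (TY _ Tx).
  have xy0 := mdist_ge0 x (val y).
  (* An admissible radius at [x] is [r], or [3 / 4 * r] if [W] comes from the point at distance less
     than [r / 4]; half of either exceeds [r / 4], and [s] exceeds that half. *)
  apply: sV; case: Pxy => PW; first by have := smax _ _ PW; lra.
  have /smax : P x (3 / 4 * r) W.
    by apply: shrink PW _ _; [rewrite metric_sym|]; lra.
  by lra.
- apply: cltNge => mV; apply: NmT; apply: cle_trans mV _.
  apply: (@cle_rel _ _ (fun (w : V @` T) (x : T) => V (val x) = val w)).
    by move=> [w /= /set_mem[x Tx <-]]; exists (SigSub (mem_set Tx)).
  by move=> w w' x Vw Vw'; apply: val_inj; rewrite -Vw.
Qed.

End metric.

(** * Cellularity *)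

Section cellularity_bound.
Variables (R : realType) (X : metricType R) (B : bornology X).

Lemma nbhs_tauP (f : C_tau R B) (O : set (C_tau R B)) :
  nbhs f O <-> exists A e, [/\ bounded B A, 0 < e &
    forall g : C_tau R B, (forall x, A x ->
      `|(f : continuousType X R) x - (g : continuousType X R) x| < e) -> O g].
Proof.
rewrite -nbhs_entourageE; split.
  move=> [E [[A e] /= [BA e0] sE] EO]; exists A, e; split=> // g fg.
  by apply: EO; apply/xsectionP; exact: sE.
move=> [A [e [BA e0 AO]]]; exists (basic_ent A e); first by exists (A, e).
by move=> g /xsectionP; exact: AO.
Qed.

Lemma cle_cellularity (F : set (set (C_tau R B))) :
  cellular_family F -> cle F (cellularity (C_tau R B)).
Proof.
move=> Fcell; apply: cle_trans (cle_inr _ _).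
apply: ((@csupP _ _ (set (C_tau R B)) _).1 (exist _ F Fcell)) => -[G Gcell] /=.
exact: cle_setT.
Qed.

(** Urysohn's lemma separates the parts of [T] outside and inside [S], both closed as subsets of a
    locally finite set. *)
Lemma continuous_indicator (T S : set X) : locally_finite T ->
  exists f : continuousType X R,
    forall x, T x -> f x = (x \in S)%:R.
Proof.
move=> Tlf.
have sub_closed : closed (T `\` S) /\ closed (T `&` S).
  by split; apply: locally_finite_closed (@metric_accessible _ X) _ _;
    apply: locally_finiteS Tlf; [exact: subDsetl|exact: subIsetl].
have sep : uniform_separator (T `\` S) (T `&` S).
  apply: normal_uniform_separator sub_closed.1 sub_closed.2 _.
    exact: pseudometric_normal.
  by rewrite -subset0 => x [[_ NSx] [_ /NSx]].
have ctsf : continuous (Urysohn (T `\` S) (T `&` S) : X -> R).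
  exact: Urysohn_continuous.
exists (mkcts ctsf) => x Tx; rewrite /mkcts /=.
have [Sx|NSx] := boolP (x \in S).
  by apply: (Urysohn_sub1 sep); exists x => //; split=> //; exact: set_mem.
apply: (Urysohn_sub0 sep); exists x => //; split=> //.
by move=> Sx; rewrite (mem_set Sx) in NSx.
Qed.

Lemma cle_pow_cellularity (T : set X) :
  bounded B T -> locally_finite T -> cle (T -> bool) (cellularity (C_tau R B)).
Proof.
move=> BT Tlf.
pose lift (S : T -> bool) : set X := [set x | exists t : T, val t = x /\ S t].
have liftE S (t : T) : (val t \in lift S) = S t.
  apply/idP/idP => [/set_mem[t' [/val_inj->]]//|St].
  by apply/mem_set; exists t.
have [f fE] := choice (fun S => continuous_indicator (lift S) Tlf).
(* Two distinct indicators differ by 1 at some point of [T], so no function is within [1 / 2] of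
   both. *)
pose O S : set (C_tau R B) := [set g : C_tau R B | forall x, T x ->
  `|f S x - (g : continuousType X R) x| < 1 / 2].
have OS S : (O S)^° (f S : C_tau R B).
  by apply/nbhs_tauP; exists T, (1 / 2); split=> //; lra.
have O_inj S S' : O S `&` O S' !=set0 -> S = S'.
  move=> [g [gS gS']]; apply/funext => t; rewrite -!liftE.
  have Tt : T (val t) := set_mem (valP t).
  have := gS' _ Tt; have := gS _ Tt; rewrite !fE //.
  rewrite !ltr_norml; case: (_ \in lift S); case: (_ \in lift S') => //=; lra.
(* Interiors are taken because a strict inequality at each point of [T] need not define an open
   set. *)
pose F := [set (O S)^° | S in [set: T -> bool]].
apply: (@cle_trans F); last first.
  apply: cle_cellularity; split=> [_ [S _ <-]|].
    by split; [exact: open_interior|exists (f S)].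
  move=> _ _ [S _ <-] [S' _ <-] [g [gS gS']].
  rewrite (O_inj S S') //; exists g; split; first exact: interior_subset gS.
  exact: interior_subset gS'.
apply: (@cle_rel _ F (fun S U => val U = (O S)^°)) => [S|S S' U -> SS'].
  by exists (SigSub (mem_set (imageT (fun S => (O S)^°) S))).
apply: O_inj; exists (f S); split; first exact: interior_subset (OS S).
by have := OS S; rewrite SS'; exact: interior_subset.
Qed.

(** For infinite [m] below the supremum, the closure of some bounded set has a cover without small
    subcover, hence contains a locally finite set of size at least [m]; the closed base makes this
    set bounded. *)
Lemma cellularity_ge : has_closed_base B ->
  cle (cpow_lt bool (bornology_delta B)) (cellularity (C_tau R B)).
Proof.
move=> [B0 [B0B B0base] B0closed].
apply: csup_le => -[m [m_delta N_delta_m]] /=.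
(* For finite [m], the power is absorbed by the summand [nat] of the cellularity. *)
have [nat_m|/cltNge m_nat] := pselect (cle nat m); last first.
  apply: (cle_trans _ (cle_inl nat _)).
  apply: cle_trans (cle_fun_nat_finite m_nat).
  apply: (@cle_inj _ _ (fun f x => nat_of_bool (f x))) => f g fg.
  apply/funext => x; have := congr1 (fun h => h x) fg.
  by case: (f x) (g x) => -[].
have [A NA] : exists A : {A : set X | bounded B A},
    ~ cle (delta (closure (sval A))) m.
  by apply/existsNP => Am; apply: N_delta_m; exact: csup_le.
have Ncov : ~ small_covers (closure (sval A)) m by move/(delta_le nat_m).
have [T [TA Tlf mT]] := locally_finite_large (@closed_closure _ _) Ncov.
apply: cle_trans (cle_pow_bool mT) _; apply: cle_pow_cellularity => //.
have [A0 B0A0 AA0] := B0base _ (svalP A).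
apply: (bounded_sub (B0B _ B0A0)); apply: subset_trans TA _.
by have /closure_id -> := B0closed _ B0A0; exact: closure_subset.
Qed.

End cellularity_bound.

Lemma dense_setT (Y : topologicalType) : dense [set: Y].
Proof. by move=> O O0 _; rewrite setIT. Qed.

Lemma cle_cellularity_density (Y : topologicalType) :
  cle (cellularity Y) (density Y).
Proof.
apply: cle_sum; first exact: cle_refl.
have [[D ->] _] := @cminP _ (fun D : {D : set Y | dense D} => sval D : cardinal)
  (exist _ setT (@dense_setT Y)).
apply: csup_le => -[F [Fop Ftriv]] /=.
apply: (@cle_rel F (sval D) (fun U d => (val U : set Y) (val d))).
  move=> [U /= /set_mem FU]; have [Uop U0] := Fop _ FU.
  have [d [Ud Dd]] := svalP D U U0 Uop.
  by exists (SigSub (mem_set Dd)).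
move=> U U' d Ud U'd; apply: val_inj.
by apply: (Ftriv _ _ (set_mem (valP U)) (set_mem (valP U'))); exists (val d).
Qed.

(** * Density *)

Section separated.
Variables (R : realType) (X : metricType R).
Implicit Types (x y z : X) (A T D F : set X) (e : R).

Definition separated_by e T :=
  forall x y, T x -> T y -> mdist x y < e -> x = y.

Lemma separated_locally_finite e T :
  0 < e -> separated_by e T -> locally_finite T.
Proof.
move=> e0 Tsep; apply: locally_finite_subsingleton => x.
exists (ball x (e / 2)) => [|y z]; first by apply: nbhsx_ballx; lra.
rewrite ballEmdist /= => Ty xy Tz xz; apply: Tsep => //.
by rewrite metric_sym in xy; have := mdist_lt_trans xy xz; rewrite -splitr.
Qed.

Lemma separated_net e A : exists D, [/\ D `<=` A, separated_by e D &
  forall y, A y -> D y \/ exists2 x, D x & mdist x y < e].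
Proof. by apply: maximal_independent => x y; rewrite metric_sym. Qed.

(** As [2 * e' <= e], a point of [D] is within [e'] of at most one point of [T]. *)
Lemma cle_separated_net (e e' : R) A T D : 0 < e' -> 2 * e' <= e ->
    T `<=` A -> separated_by e T ->
    (forall y, A y -> exists2 x, D x & mdist x y < e') ->
  cle T D.
Proof.
move=> e'0 ee' TA Tsep Dnet.
apply: (@cle_rel T D (fun t d => mdist (val d) (val t) < e')).
  move=> [t /= /set_mem /TA/Dnet[d Dd dt]].
  by exists (SigSub (mem_set Dd)).
move=> t t' d dt dt'; apply/val_inj/Tsep; [exact/set_mem/valP..|].
by rewrite metric_sym in dt; have := mdist_lt_trans dt dt'; lra.
Qed.

Lemma finite_separated T : finite_set T -> exists2 e, 0 < e & separated_by e T.
Proof.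
move=> /finite_seqP[s ->]; elim: s => [|x s [e e0 es]]; first by exists 1.
have [xs|xs] := boolP (x \in s).
  exists e => // y z /=; rewrite !inE => ys zs; apply: es => /=.
    by case/predU1P: ys => [->|].
  by case/predU1P: zs => [->|].
have /nbhs_ballP[r /= r0 rs] : nbhs x (~` [set` s]).
  apply: open_nbhs_nbhs; split; last exact/negP.
  have /accessible_finite_set_closed finite_closed := @metric_accessible _ X.
  by rewrite openC; exact: finite_closed (finite_seq s).
have far y : y \in s -> r <= mdist x y.
  move=> ys; rewrite leNgt; apply/negP => xy; apply: (rs y) => //.
  by rewrite ballEmdist.
exists (Num.min e r); first by rewrite lt_min e0.
move=> y z /=; rewrite !inE lt_min => ys zs /andP[yz1 yz2].
case/predU1P: ys yz1 yz2 => [->|ys]; case/predU1P: zs => [->|zs] // yz1 yz2.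
- by have := far _ zs; rewrite leNgt yz2.
- by have := far _ ys; rewrite leNgt metric_sym yz2.
- exact: es.
Qed.

(** The bound [k] is common to all scales [e]. Separate bounds below [l] could have supremum [l]
    when [l] has countable cofinality. *)
Definition separated_le F (k : cardinal) :=
  forall e T, 0 < e -> T `<=` F -> separated_by e T -> cle T k.

Lemma separated_le_finite F (k : cardinal) :
  clt k nat -> separated_le F k -> finite_set F.
Proof.
move=> [_ Nnat_k] Fk; apply: contrapT => /infiniteP natF.
have /cleP[f f_inj] : cle nat F.
  by rewrite cle_setE.
have /finite_set_leP[n kn] : finite_set [set: k].
  by apply: contrapT => /infiniteP.
have [|e e0 Tsep] := @finite_separated ((val \o f) @` `I_n.+1).
  exact: finite_image.
apply: (@cle_injective_image _ (val \o f) n k).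
- by move=> i j /val_inj /f_inj.
- apply: Fk e0 _ Tsep => _ [i _ <-]; exact: (set_mem (valP (f i))).
- by rewrite cle_setE.
Qed.

(** For infinite [k], the maximal separated subsets at the scales [1 / (n + 1)] have a dense union
    of size at most [nat * k], that is [k]; for finite [k], [F] itself is finite. *)
Lemma separated_le_dense F (k l : cardinal) :
    cle nat l -> clt k l -> separated_le F k ->
  exists E : set X, [/\ clt E l, E `<=` F & F `<=` closure E].
Proof.
move=> nat_l kl Fk; have [nat_k|/cltNge k_nat] := pselect (cle nat k); last first.
  exists F; split=> //; last exact: subset_closure.
  have Ffin := separated_le_finite k_nat Fk.
  apply: (clt_cle_trans _ nat_l); apply: cltNge.
  by rewrite cle_setE => /infiniteP; apply.
have [D /all_and3[DF Dsep Dnet]] :=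
  choice (fun n => separated_net n.+1%:R^-1 F).
exists (\bigcup_n D n); split.
- apply: cle_clt_trans kl.
  apply: (cle_trans (@cle_bigcup _ D k _)); last exact: cle_mul (cle_refl k).
  by move=> n; apply: Fk (DF n) (Dsep n); rewrite invr_gt0.
- by move=> x [n _ /DF].
- move=> x Fx N /nbhs_ballP[e /= e0 eN].
  have [n ne] := natSinv_lt e0.
  have [Dx|[y Dy yx]] := Dnet n x Fx.
    by exists x; split; [exists n|apply: eN; exact: ballxx].
  exists y; split; first by exists n.
  by apply: eN; rewrite ballEmdist /= metric_sym; exact: lt_trans ne.
Qed.

Lemma locally_finite_bigcup (T : nat -> set X) :
    (forall n, locally_finite (T n)) ->
    (forall x, exists2 N, nbhs x N &
      exists n, forall m, (n <= m)%N -> T m `&` N = set0) ->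
  locally_finite (\bigcup_n T n).
Proof.
move=> Tlf Tev x; have [N Nx [n NT]] := Tev x.
have [N' N'x N'T] : exists2 N', nbhs x N' &
    forall m, (m < n)%N -> finite_set (T m `&` N').
  elim: (n) => [|k [N' N'x N'T]]; first by exists setT => //; exact: filterT.
  have [N'' N''x TN''] := Tlf k x.
  exists (N' `&` N'') => [|m]; first exact: filterI.
  rewrite ltnS leq_eqVlt => /predU1P[->|/N'T].
    by apply: sub_finite_set TN''; apply: setIS; exact: subIsetr.
  by apply: sub_finite_set; apply: setIS; exact: subIsetl.
exists (N `&` N'); first exact: filterI.
apply: (@sub_finite_set _ _ (\bigcup_(m in `I_n) (T m `&` N'))).
  move=> y [[m _ Tmy] [Ny N'y]]; exists m => //=.
  rewrite ltnNge; apply/negP => /NT TN.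
  by have : set0 y by rewrite -TN.
by apply: bigcup_finite => // m /= /N'T.
Qed.

Section eventually_small.
Variables (A : set X) (l : cardinal).
Hypothesis Alf : forall T, T `<=` A -> locally_finite T -> clt T l.

(* This is where the case of [l] of countable cofinality is handled: large
   separated subsets of all the [F n] would unite into a locally finite set
   that is too large. *)
Lemma eventually_separated_le (F : nat -> set X) :
    (forall n, F n `<=` A) ->
    (forall x, exists2 N, nbhs x N &
      exists n, forall m, (n <= m)%N -> F m `&` N = set0) ->
  exists n, exists2 k : cardinal, clt k l & separated_le (F n) k.
Proof.
move=> FA Fev; apply: contrapT => NF.
have large n (k : cardinal) : clt k l -> exists T e,
    [/\ 0 < e, T `<=` F n, separated_by e T & ~ cle T k].
  move=> kl; apply: contrapT => NT; apply: NF; exists n, k => // e T e0 TF Tsep.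
  by apply: contrapT => Tk; apply: NT; exists T, e.
have inv0 n : 0 < n.+1%:R^-1 :> R by rewrite invr_gt0.
have [D /all_and3[DA Dsep Dnet]] :=
  choice (fun n => separated_net n.+1%:R^-1 A).
have Dl n : clt (D n) l.
  by apply: Alf => //; exact: separated_locally_finite (inv0 n) (Dsep n).
have [T Tlarge] := choice (fun n => large n (D n) (Dl n)).
have DT n : cle (D n) (T n).
  by have [e [_ _ _ /cleNge]] := Tlarge n.
have TF n : T n `<=` F n by have [e []] := Tlarge n.
have Sl : clt (\bigcup_n T n) l.
  apply: Alf; first by move=> x [n _ /TF/FA].
  apply: locally_finite_bigcup => [n|x].
    by have [e [e0 _ + _]] := Tlarge n; exact: separated_locally_finite.
  have [N Nx [n FN]] := Fev x; exists N => //; exists n => m /FN FN0.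
  by rewrite -subset0 -FN0; exact: setSI.
(* A separated subset of [F 0] larger than the union of the [T n] is impossible: for large [n] it
   embeds in the net [D n], hence in [T n]. *)
have [T' [e [e0 T'F T'sep]]] := large 0%N _ Sl; apply.
have e20 : 0 < e / 2 by lra.
have [n ne] := natSinv_lt e20.
apply: (@cle_trans (D n)); last first.
  by apply: cle_trans (DT n) _; apply: cle_subset => x Tx; exists n.
have T'A := subset_trans T'F (FA 0%N).
apply: (cle_separated_net (inv0 n) _ T'A T'sep) => [|y Ay].
  by move: ne; set r := _^-1; lra.
by have [Dy|//] := Dnet n y Ay; exists y => //; rewrite mdistxx.
Qed.

End eventually_small.
End separated.

(** * Approximation on one set by coded functions *)

Section approximation.
Variables (R : realType) (X : metricType R) (A : set X) (l : cardinal).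
Hypothesis nat_l : cle nat l.
Hypothesis Alf : forall T : set X, T `<=` A -> locally_finite T -> clt T l.
Implicit Types (f g : continuousType X R) (x y z : X).

Lemma clt_set0 : clt (set0 : set X) l.
Proof.
apply: cltNge => /(cle_trans nat_l)/cleP[i _].
by have := set_mem (valP (i 0%N)).
Qed.

Let radius n : R := n.+1%:R^-1.

Let radius_gt0 n : 0 < radius n.
Proof. by rewrite invr_gt0. Qed.

Section coding.
Variable e : R.
Hypothesis e0 : 0 < e.

Let steady f x (r : R) :=
  forall y z, mdist x y < r -> mdist x z < r -> `|f y - f z| < e.

Lemma steady_exists f x : exists2 r, 0 < r & steady f x r.
Proof.
have e20 : 0 < e / 2 by rewrite divr_gt0.
have /nbhs_ballP[r /= r0 fr] : nbhs x (f @^-1` ball (f x) (e / 2)).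
  exact: (@cts_fun _ _ f) (nbhsx_ballx _ _ e20).
exists r => // y z xy xz.
have near t : mdist x t < r -> `|f x - f t| < e / 2.
  by move=> xt; apply: fr; rewrite ballEmdist.
by have := near _ xy; have := near _ xz; rewrite !ltr_norml; lra.
Qed.

Let wild f n := [set y | A y /\ ~ steady f y (radius n)].

(** Balls of radius below [r / 2] centred in [ball x (r / 2)] stay in [ball x r], where [f] varies
    by less than [e]. *)
Lemma wild_eventually0 f x : exists2 N, nbhs x N &
  exists n, forall m, (n <= m)%N -> wild f m `&` N = set0.
Proof.
have [r r0 fr] := steady_exists f x.
exists (ball x (r / 2)); first by apply: nbhsx_ballx; lra.
have [n nr] : exists n, radius n < r / 2 by apply: natSinv_lt; lra.
exists n => m nm; rewrite -subset0 => y [[_ Ny]]; rewrite ballEmdist /= => xy.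
have mr : radius m < r / 2.
  by apply: le_lt_trans nr; rewrite lef_pV2 ?posrE ?ltr0n// ler_nat ltnS.
apply: Ny => z t yz yt; apply: fr.
  by have := mdist_lt_trans xy yz; lra.
by have := mdist_lt_trans xy yt; lra.
Qed.

Lemma wild_separated_le f :
  exists n, exists2 k : cardinal, clt k l & separated_le (wild f n) k.
Proof.
apply: (eventually_separated_le Alf) => [n y []//|].
exact: wild_eventually0.
Qed.

Variable D : nat -> set X.
Hypothesis DA : forall n, D n `<=` A.
Hypothesis Dsep : forall n, separated_by (radius n / 2) (D n).
Hypothesis Dnet : forall n y, A y ->
  exists2 x, D n x & mdist x y < radius n / 2.

Variable q : R -> nat.
Hypothesis q_near : forall a b, q a = q b -> `|a - b| < e.

(* [a d = 0] marks the points [d] of the net around which the coded function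
   is not steady; the other values are approximations of the function. *)
Let rest n (a : D n -> nat) :=
  [set y | A y /\ forall d : D n, a d <> 0%N -> radius n / 2 <= mdist (val d) y].

(** The choice depends on [a] only, so functions sharing [n] and [a] are sampled on the same set.
    The default [set0] still has cardinality below [l]. *)
Let skeleton n (a : D n -> nat) : set X :=
  xget set0 [set E : set X | [/\ clt E l, E `<=` rest a & rest a `<=` closure E]].

Lemma clt_skeleton n (a : D n -> nat) : clt (skeleton a) l.
Proof. by rewrite /skeleton; case: xgetP => [E _ []|_] //; exact: clt_set0. Qed.

Let code := {n : nat & {a : D n -> nat & skeleton a -> nat}}.

(** Nets, being locally finite, and skeletons, by choice, are below [l]; so the two maps in a code
    take at most [cpow_lt bool l] values each, and this infinite cardinal absorbs the products. *)
Lemma cle_code : cle code (cpow_lt bool l).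
Proof.
have nat_P := cle_nat_cpow_lt nat_l.
set P := cpow_lt bool l in nat_P *.
have /all_sig[i i_inj] : forall n, {i : (D n -> nat) -> P | injective i}.
  move=> n; apply/cid/cleP; apply: cle_fun_nat => //; apply: (Alf (@DA n)).
  by apply: separated_locally_finite _ (@Dsep n); rewrite divr_gt0.
have /all_sig[j j_inj] : forall n, {j : forall a : D n -> nat,
    (skeleton a -> nat) -> P | forall a, injective (j a)}.
  move=> n.
  have /all_sig[j j_inj] : forall a : D n -> nat,
      {j : (skeleton a -> nat) -> P | injective j}.
    by move=> a; apply/cid/cleP; apply: cle_fun_nat => //; exact: clt_skeleton.
  by exists j.
apply: (@cle_trans (nat * (P * P))%type).
  apply: (@cle_inj _ _ (fun c : code => (projT1 c,
    (i _ (projT1 (projT2 c)), j _ _ (projT2 (projT2 c)))))).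
  move=> [n [a b]] [n' [a' b']] /= [nn']; subst n'.
  by move=> /i_inj aa'; subst a' => /j_inj ->.
by apply: cle_mul => //; apply: cle_mul => //; exact: cle_refl.
Qed.

(** The successor frees [0] for the mark. The first clause is what provides [rest a] with a dense
    subset below [l]. *)
Let codes f (c : code) := let: existT n (existT a b) := c in
  [/\ exists2 k : cardinal, clt k l & separated_le (wild f n) k,
      forall d : D n, if a d is m.+1 then
        steady f (val d) (radius n / 2) /\ m = q (f (val d))
        else ~ steady f (val d) (radius n / 2) &
      forall z : skeleton a, b z = q (f (val z))].

Lemma codes_exists f : exists c, codes f c.
Proof.
have [n small] := wild_separated_le f.
pose a (d : D n) := if pselect (steady f (val d) (radius n / 2)) is left _
  then (q (f (val d))).+1 else 0%N.
exists (existT _ n (existT _ a (fun z : skeleton a => q (f (val z))))); split=> // d.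
by rewrite /a; case: pselect.
Qed.

(** A point [y] of [rest a] is within [radius n / 2] of a net point [d], necessarily marked [0].
    Steadiness at [y] for [radius n] would pass to the smaller ball at [d]; so [rest a] lies in
    [wild f n], and [skeleton a] is not a default. *)
Lemma rest_closure f n (a : D n -> nat) b :
  codes f (existT _ n (existT _ a b)) -> rest a `<=` closure (skeleton a).
Proof.
move=> [[k kl wild_k] fa _].
have rest_wild : rest a `<=` wild f n.
  move=> y [Ay ya]; split=> // fy; have [d Dd dy] := Dnet n Ay.
  pose d' : D n := SigSub (mem_set Dd).
  have := fa d'; case ad : (a d') => [|m].
    apply=> z t dz dt; rewrite metric_sym in dy; apply: fy.
      by have := mdist_lt_trans dy dz; rewrite -splitr.
    by have := mdist_lt_trans dy dt; rewrite -splitr.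
  have dy' : radius n / 2 <= mdist d y by apply: (ya d'); rewrite ad.
  by rewrite ltNge dy' in dy.
have rest_k : separated_le (rest a) k.
  by move=> r T r0 /subset_trans/(_ rest_wild); exact: wild_k.
have [E [El EF FE]] := separated_le_dense nat_l kl rest_k.
rewrite /skeleton; case: xgetP => [E' _ []//|/(_ E)NE].
by case: NE.
Qed.

(** The values at [y] are compared through a point [z] where the codes agree: a net point around
    which both functions are steady or, by continuity, a skeleton point close to [y]. The factor 3
    counts the steps between [f y], [f z], [g z] and [g y]. *)
Lemma codes_near f g c y :
  codes f c -> codes g c -> A y -> `|f y - g y| < 3 * e.
Proof.
case: c => n [a b] fc gc Ay; have [_ fa fb] := fc; have [_ ga gb] := gc.
have chain z : `|f y - f z| < e -> `|g y - g z| < e -> q (f z) = q (g z) ->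
    `|f y - g y| < 3 * e.
  by move=> fyz gyz /q_near; move: fyz gyz; rewrite !ltr_norml; lra.
have [[d ad dy]|far] := pselect (exists2 d : D n,
    a d <> 0%N & mdist (val d) y < radius n / 2).
  have dd : mdist (val d) (val d) < radius n / 2.
    by rewrite mdistxx divr_gt0.
  have := fa d; have := ga d; case: (a d) ad => // m _ [sg ->] [sf qfg].
  by apply: (chain (val d)); [exact: sf|exact: sg|].
have : closure (skeleton a) y.
  apply: (rest_closure fc); split=> // d ad; rewrite leNgt; apply/negP => dy.
  by apply: far; exists d.
have [r r0 fr] := steady_exists f y; have [s s0 gs] := steady_exists g y.
move=> /(_ _ (filterI (nbhsx_ballx y r r0) (nbhsx_ballx y s s0))).
move=> [z [Ez]]; rewrite !ballEmdist => -[/= yr ys].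
apply: (chain z).
- by apply: fr; rewrite ?mdistxx.
- by apply: gs; rewrite ?mdistxx.
- by rewrite -(fb (SigSub (mem_set Ez))) gb.
Qed.

Lemma coded_approximation : exists h : cpow_lt bool l -> continuousType X R,
  forall f, exists p, forall y, A y -> `|f y - h p y| < 3 * e.
Proof.
have /cleP[i i_inj] := cle_code.
have [p|h hP] := @choice _ _ (fun p g => forall f c, codes f c -> i c = p ->
    forall y, A y -> `|f y - g y| < 3 * e).
  have [[g [c [gc cp]]]|N] := pselect (exists g c, codes g c /\ i c = p).
    exists g => f c' fc'; rewrite -cp => /i_inj cc' y.
    by rewrite cc' in fc'; exact: codes_near fc' gc.
  (* Default value for an index [p] that comes from no code of a function. *)
  exists (mkcts (@cst_continuous X R 0)) => f c fc cp; case: N.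
  by exists f, c.
exists h => f; have [c fc] := codes_exists f.
by exists (i c); exact: hP fc erefl.
Qed.

End coding.

Lemma approximation (e : R) : 0 < e ->
  exists h : cpow_lt bool l -> continuousType X R,
    forall f, exists p, forall y, A y -> `|f y - h p y| < e.
Proof.
move=> e0.
have e30 : 0 < e / 3 by lra.
have r0 n : 0 < radius n / 2 by rewrite divr_gt0.
have [D /all_and3[DA Dsep Dnet]] :=
  choice (fun n => separated_net (radius n / 2) A).
have [q q_near] := nat_quantization e30.
have Dnet' n y : A y -> exists2 x, D n x & mdist x y < radius n / 2.
  by move=> /(Dnet n)[Dy|//]; exists y => //; rewrite mdistxx.
have [h hP] := coded_approximation e30 DA Dsep Dnet' q_near.
exists h => f; have [p fp] := hP f; exists p => y /fp.
by rewrite (_ : 3 * (e / 3) = e)//; lra.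
Qed.

End approximation.

(** * Gathering the approximations over a base *)

Section density_bound.
Variables (R : realType) (X : metricType R) (B : bornology X).

(** A bound independent of [A], from which the supremum [bornology_delta] exists. *)
Lemma cle_delta_subset (A : set X) :
  cle (delta (closure A)) (nat + set (set X))%type.
Proof.
have [L -> [_ Lmin]] := deltaP (closure A).
apply: cle_sum (cle_refl nat) _; apply/Lmin/small_covers_set.
by do 2 apply: cle_set; exact: cle_setT.
Qed.

Lemma cle_bornology_delta (A : set X) :
  bounded B A -> cle (delta (closure A)) (bornology_delta B).
Proof.
move=> BA; apply: ((@csupP _ _ (nat + set (set X))%type _).1 (exist _ A BA)).
by move=> A'; exact: cle_delta_subset.
Qed.

Lemma cle_nat_bornology_delta : cle nat (bornology_delta B).
Proof. exact: cle_trans (cle_inl _ _) (cle_bornology_delta (bounded0 B)). Qed.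

Lemma density_le :
  cle (density (C_tau R B)) (cf B * cpow_lt bool (bornology_delta B))%type.
Proof.
set l := bornology_delta B; set P := cpow_lt bool l.
have nat_l : cle nat l := cle_nat_bornology_delta.
have nat_P : cle nat P := cle_nat_cpow_lt nat_l.
have Blf (A T : set X) : bounded B A -> T `<=` A -> locally_finite T -> clt T l.
  move=> BA TA Tlf; apply: clt_cle_trans (cle_bornology_delta BA).
  apply: clt_locally_finite Tlf; first exact: metric_accessible.
  exact: subset_trans TA (@subset_closure _ A).
(* The bornology itself is a base, so the minimum in [cf] is over a nonempty family. *)
rewrite /cf; have [[[B0 [B0B B0base]] ->] _] := @cminP _
  (fun B0 : {B0 : set (set X) | is_base B B0} => sval B0 : cardinal)
  (exist _ (bounded B : set (set X)) (conj (@subset_refl _ _)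
    (fun A BA => ex_intro2 _ _ A BA (@subset_refl _ _)))).
rewrite [sval _]/=.
have /all_sig[h hP] : forall p : B0 * nat,
    {h : P -> continuousType X R | forall f : continuousType X R,
      exists c, forall y, (val p.1 : set X) y -> `|f y - h c y| < p.2.+1%:R^-1}.
  move=> [A n]; apply: cid; apply: approximation => // T.
  exact: Blf (B0B _ (set_mem (valP A))).
pose D : set (C_tau R B) := range (fun p => h p.1 p.2 : C_tau R B).
have Ddense : dense D.
  move=> O [f Of] Oop.
  have /nbhs_tauP[A [e [BA e0 AO]]] : nbhs f O by apply: open_nbhs_nbhs.
  have [A0 B0A0 AA0] := B0base _ BA; have [n ne] := natSinv_lt e0.
  have [c fc] := hP (SigSub (mem_set B0A0), n) f.
  eexists; split; last by exists ((SigSub (mem_set B0A0), n), c).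
  by apply: AO => x /AA0 /fc /lt_trans; apply.
have [_ /(_ (exist _ D Ddense)) /= dD] := @cminP _
  (fun D : {D : set (C_tau R B) | dense D} => sval D : cardinal)
  (exist _ D Ddense).
apply: (@cle_trans (nat + B0 * P)%type).
  apply: cle_sum (cle_refl nat) _; apply: cle_trans dD _.
  apply: cle_trans (cle_range _) _.
  apply: (@cle_trans (B0 * (nat * P))%type).
    apply: (@cle_inj _ _ (fun p => (p.1.1, (p.1.2, p.2)))).
    by move=> [[? ?] ?] [[? ?] ?] [-> -> ->].
  apply: cle_prod (cle_refl _) _; exact: cle_mul (cle_refl P).
(* The summand [nat] of the density goes into that of [cf B], paired with a fixed element of [P]. *)
have /cleP[i _] := nat_P.
apply: (@cle_inj _ _ (fun s : nat + B0 * P => match s with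
  inl n => (inl n, i 0%N) | inr p => (inr p.1, p.2) end)).
by move=> [n|[A c]] [n'|[A' c']] // [] => [->|-> ->].
Qed.

End density_bound.

Theorem theorem3p11 (R : realType) (X : metricType R) (B : bornology X)
    (closed_base : has_closed_base B) :
  [/\ cle (cpow_lt bool (bornology_delta B)) (cellularity (C_tau R B)),
      cle (cellularity (C_tau R B)) (density (C_tau R B))
    & cle (density (C_tau R B))
          (cf B * cpow_lt bool (bornology_delta B))%type ].
Proof.
split; first exact: cellularity_ge.
- exact: cle_cellularity_density.
- exact: density_le.
Qed.
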